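(* Fix $n\ge0$ and $k\ge1$, and let $m$ be the smallest positive integer congruent to $n$ modulo $k$. A $k$-equivalence class of plane trees with $n+1$ nodes has the largest size among all $k$-equivalence classes of plane trees with $n+1$ nodes if and only if its minimal element is $k$-admissible.
   Context: A plane tree is a rooted tree whose children at each node are linearly ordered; nodes of a plane tree with $n+1$ nodes are labelled $v_0,\dots,v_n$ in pre-order (root first, then recursively the subtrees of the root from left to right), and its multi-degree is $(d_0,\dots,d_n)$, $d_i$ the number of children of $v_i$. Binary trees: every node has $0$ or $2$ ordered children; $s\wedge t$ has left subtree $s$, right subtree $t$; iterated $\wedge$ is read left to right. A right $k$-rotation of a binary tree replaces a maximal subtree $(t_0\wedge\cdots\wedge t_k)\wedge t_{k+1}$ by $t_0\wedge(t_1\wedge\cdots\wedge t_{k+1})$; a left $k$-rotation is its inverse; $t\le t'$ in the $k$-associative order iff $t$ is obtained from $t'$ by finitely many left $k$-rotations. The bijection $\Phi$ from binary trees with $n+1$ leaves to plane trees with $n+1$ nodes: $\Phi$(leaf) is a single node, $\Phi(s\wedge t)$ is $\Phi(s)$ with $\Phi(t)$ attached as new rightmost subtree of the root. Plane trees inherit $k$-equivalence (connectedness by rotations) and the $k$-associative order via $\Phi$; each $k$-equivalence class has a unique minimal element. A plane tree with $n+1$ nodes and multi-degree $(d_0,\dots,d_n)$ is $k$-admissible if $d_{m+1}=\cdots=d_n=0$ and $(d_0-n+m,d_1,\dots,d_m)$ is the multi-degree of some plane tree with $m+1$ nodes. *)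

(* Defs.v *)
From mathcomp Require Import all_boot all_order all_algebra.
From mathcomp Require Import boolp classical_sets functions cardinality.
From Stdlib Require Relation_Operators.
Set Implicit Arguments.
Unset Strict Implicit.
Unset Printing Implicit Defensive.

Inductive ptree : Type := PNode of seq ptree.

Fixpoint nodes (p : ptree) : nat :=
  let: PNode ps := p in (sumn (map nodes ps)).+1.

(* Numbers of children, listed in pre-order. *)
Fixpoint multidegree (p : ptree) : seq nat :=
  let: PNode ps := p in size ps :: flatten (map multidegree ps).

Inductive btree : Type := Leaf | Wedge of btree & btree.

(* wedges t i l = t_i /\ t_(i+1) /\ ... /\ t_(i+l), bracketed to the left. *)
Definition wedges (t : nat -> btree) (i l : nat) : btree :=
  foldl Wedge (t i) [seq t j | j <- iota i.+1 l].

(* One right k-rotation, at the root or inside a subtree.  Only the values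
   t 0, ..., t k.+1 of the family t matter. *)
Inductive right_rotation (k : nat) : btree -> btree -> Prop :=
| right_rotation_root (t : nat -> btree) :
    right_rotation k (Wedge (wedges t 0 k) (t k.+1))
                     (Wedge (t 0) (wedges t 1 k))
| right_rotation_l (s s' u : btree) :
    right_rotation k s s' -> right_rotation k (Wedge s u) (Wedge s' u)
| right_rotation_r (s u u' : btree) :
    right_rotation k u u' -> right_rotation k (Wedge s u) (Wedge s u').

Definition left_rotation (k : nat) (s t : btree) : Prop := right_rotation k t s.

Definition bequiv (k : nat) : btree -> btree -> Prop :=
  Relation_Operators.clos_refl_sym_trans btree (right_rotation k).

Definition ble (k : nat) (t t' : btree) : Prop :=
  Relation_Operators.clos_refl_trans btree (left_rotation k) t' t.

Fixpoint Phi (b : btree) : ptree :=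
  if b is Wedge s t then
    let: PNode ps := Phi s in PNode (rcons ps (Phi t))
  else PNode [::].

Definition pequiv (k : nat) (p q : ptree) : Prop :=
  exists s t : btree, [/\ Phi s = p, Phi t = q & bequiv k s t].

Definition ple (k : nat) (p q : ptree) : Prop :=
  exists s t : btree, [/\ Phi s = p, Phi t = q & ble k s t].

(* Rotations preserve the number of leaves, so all members of a class have the
   same number of nodes as its representative p. *)
Definition kclass (n k : nat) (C : set ptree) : Prop :=
  exists2 p : ptree, nodes p = n.+1 & C = [set q | pequiv k p q]%classic.

(* The classes are finite; #<= compares their sizes. *)
Definition largest_kclass (n k : nat) (C : set ptree) : Prop :=
  kclass n k C /\ forall D : set ptree, kclass n k D -> (D #<= C)%card.

Definition minimal_in (k : nat) (C : set ptree) (p : ptree) : Prop :=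
  C p /\ forall q : ptree, C q -> ple k q p -> q = p.

Definition smallest_pos_residue (n k m : nat) : Prop :=
  [/\ 0 < m, m = n %[mod k] &
      forall m' : nat, 0 < m' -> m' = n %[mod k] -> m <= m'].

(* k-admissibility depends on k only through m, the smallest
   positive integer congruent to n modulo k.
   d_0 - n + m is an integer, possibly negative.  One has m <= n unless n = 0,
   in which case m = k and the missing d_1, ..., d_m are read as 0. *)
Definition admissible (n m : nat) (p : ptree) : Prop :=
  let d := nth 0 (multidegree p) in
  [/\ nodes p = n.+1,
      forall i : nat, m < i <= n -> d i = 0 &
      exists2 q : ptree, nodes q = m.+1 &
        [seq Posz e | e <- multidegree q] =
        (Posz (d 0) - Posz n + Posz m)%R :: [seq Posz (d i) | i <- iota 1 m]].

(* Main.v *)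
(**
  Reading the children counts d_1, ..., d_n of the non-root nodes in pre-order
  identifies plane trees with n + 1 nodes with the words of length n all of
  whose suffixes x w satisfy x + sum(w) <= |w| (Lukasiewicz words); the root
  degree is n - sum d_i.  A right k-rotation moves k children from a node to
  a child of that node, so the residues d_i mod k are invariant, and left rotations lead
  to a tree with all d_i < k; hence the classes are the fibres of the residue
  word r, and the minimal element of a class has d_i = r_i.

  Writing d_i = a_i k + r_i, the class of r becomes a set A(r) of quotient words
  a, and A(r) is contained in A(0).  So the class of r has the largest size iff A(r) = A(0).
  Testing words a with a single nonzero letter floor((n - i) / k) shows that
  this means sum_{j >= i} r_j <= (n - i) mod k for all i >= 1, which is
  k-admissibility because (n - i) mod k = m - i for i <= m.
*)

Require Import Defs.
From mathcomp Require Import all_boot all_order all_algebra.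
From mathcomp Require Import boolp classical_sets functions cardinality.
From mathcomp Require Import finmap.
From Stdlib Require Import Relation_Operators.
From mathcomp Require Import zify.

(** * Plane trees and Lukasiewicz words *)

Lemma ptree_nested_ind (P : ptree -> Prop) :
  (forall ps, foldr (fun p Q => P p /\ Q) True ps -> P (PNode ps)) ->
  forall p, P p.
Proof.
move=> IH; fix rec 1 => -[ps]; apply: IH.
by elim: ps => [|p ps IHps]; [|split; [exact: rec|]].
Qed.

Definition forest_word (ps : seq ptree) : seq nat :=
  flatten (map multidegree ps).

(** Read from the right, [w'] parses into [size w' - sumn w'] trees; the inequality says that enough
    of them are available to become the [x] children of the next node. *)
Fixpoint lukasiewicz (w : seq nat) : bool :=
  if w is x :: w' then (x + sumn w' <= size w') && lukasiewicz w' else true.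

(* Parses a word from right to left; [ps] is the forest read so far. *)
Definition decode (w : seq nat) : seq ptree :=
  foldr (fun x ps => PNode (take x ps) :: drop x ps) [::] w.

Lemma forest_word_cons p ps :
  forest_word (p :: ps) = multidegree p ++ forest_word ps.
Proof. by []. Qed.

Lemma forest_word_cat ps qs :
  forest_word (ps ++ qs) = forest_word ps ++ forest_word qs.
Proof. by rewrite /forest_word map_cat flatten_cat. Qed.

Lemma luka_sumn w : lukasiewicz w -> sumn w <= size w.
Proof. by case: w => //= x w /andP[/leq_trans-> //]. Qed.

Lemma sumn_multidegree p : (sumn (multidegree p)).+1 = size (multidegree p).
Proof.
elim/ptree_nested_ind: p => ps /= IH; congr _.+1.
elim: ps IH => [|p ps IHps] //= [IHp /IHps]; rewrite sumn_cat size_cat; lia.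
Qed.

Lemma sumn_forest_word ps :
  size ps + sumn (forest_word ps) = size (forest_word ps).
Proof. by have /= [] := sumn_multidegree (PNode ps). Qed.

Lemma size_multidegree p : size (multidegree p) = nodes p.
Proof.
elim/ptree_nested_ind: p => ps /= IH; congr _.+1.
by elim: ps IH => [|p ps IHps] //= [IHp /IHps]; rewrite size_cat IHp => ->.
Qed.

(** Parsing from the right rebuilds the children before their parent collects them. The tail [w]
    carries the later siblings through the induction. *)
Lemma decode_multidegree p w : decode (multidegree p ++ w) = p :: decode w.
Proof.
elim/ptree_nested_ind: p w => ps IH w /=.
suff -> : decode (forest_word ps ++ w) = ps ++ decode w.
  by rewrite take_size_cat ?drop_size_cat.
elim: ps IH => [|p ps IHps] //= [IHp /IHps]; rewrite forest_word_cons -catA IHp.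
by move->.
Qed.

Lemma multidegree_inj : injective multidegree.
Proof.
move=> p q epq; have := decode_multidegree p [::].
by rewrite epq decode_multidegree => -[].
Qed.

Lemma luka_multidegree p w : lukasiewicz w -> lukasiewicz (multidegree p ++ w).
Proof.
elim/ptree_nested_ind: p w => ps IH w gw /=; apply/andP; split.
  have := sumn_forest_word ps; have := luka_sumn _ gw.
  rewrite sumn_cat size_cat -/(forest_word ps); lia.
rewrite -/(forest_word ps).
elim: ps IH => [|p ps IHps] //= [IHp /IHps gps]; rewrite forest_word_cons -catA.
exact: IHp.
Qed.

Lemma decodeK w : lukasiewicz w -> forest_word (decode w) = w.
Proof.
elim: w => [|x w IHw] //= /andP[le_x gw]; have Ew := IHw gw.
have sz : x <= size (decode w).
  by move: (sumn_forest_word (decode w)); rewrite Ew; lia.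
rewrite forest_word_cons /= size_takel // -/(forest_word _).
by rewrite -forest_word_cat cat_take_drop Ew.
Qed.

Definition subdegrees (p : ptree) : seq nat := behead (multidegree p).

Lemma multidegreeE p : multidegree p =
  (nodes p).-1 - sumn (subdegrees p) :: subdegrees p.
Proof.
have := sumn_multidegree p; rewrite -size_multidegree /subdegrees.
by case: p => ps /= [<-]; rewrite addnK.
Qed.

Lemma size_subdegrees p : size (subdegrees p) = (nodes p).-1.
Proof. by rewrite size_behead size_multidegree. Qed.

Lemma subdegrees_inj p q : nodes p = nodes q ->
  subdegrees p = subdegrees q -> p = q.
Proof.
by move=> eN eS; apply: multidegree_inj; rewrite !multidegreeE eN eS.
Qed.

Lemma luka_subdegrees p : lukasiewicz (subdegrees p).
Proof.
have := luka_multidegree p [::] isT; rewrite cats0 multidegreeE /=.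
by case/andP.
Qed.

Lemma subdegrees_surj t : lukasiewicz t ->
  exists2 p, nodes p = (size t).+1 & subdegrees p = t.
Proof.
move=> gt; have le_t := luka_sumn _ gt.
(* This first letter makes the root absorb all trees parsed from [t]; the leftover forest [ps] is
   then empty by counting. *)
have gw : lukasiewicz (size t - sumn t :: t) by rewrite /= subnK ?leqnn.
have Ew := decodeK _ gw.
have := sumn_forest_word (decode (size t - sumn t :: t)); rewrite Ew /= subnK //.
set ps := drop _ _ => sz.
have ps0 : ps = [::] by apply: size0nil; lia.
move: Ew => /=; rewrite -/ps ps0 forest_word_cons cats0 => Ew.
exists (PNode (take (size t - sumn t) (decode t))).
  by rewrite -size_multidegree Ew.
by rewrite /subdegrees Ew.
Qed.

(** * The bijection [Phi] and left spines of binary trees *)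

Fixpoint Psi (p : ptree) : btree :=
  let: PNode ps := p in foldl Wedge Leaf (map Psi ps).

Lemma Phi_foldl b bs ps : Phi b = PNode ps ->
  Phi (foldl Wedge b bs) = PNode (ps ++ map Phi bs).
Proof.
elim: bs b ps => [|c bs IH] b ps Eb /=; first by rewrite cats0.
by rewrite (IH _ (rcons ps (Phi c))) /= ?Eb // cat_rcons.
Qed.

Lemma PsiK p : Phi (Psi p) = p.
Proof.
elim/ptree_nested_ind: p => ps IH /=; rewrite (Phi_foldl _ _ [::]) //=.
by congr PNode; elim: ps IH => [|p ps IHps] //= [-> /IHps->].
Qed.

Lemma PhiK b : Psi (Phi b) = b.
Proof.
elim: b => [|s IHs t IHt] //=; case: (Phi s) IHs => ps /= <-.
by rewrite map_rcons foldl_rcons IHt.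
Qed.

Fixpoint left_depth (b : btree) : nat :=
  if b is Wedge s _ then (left_depth s).+1 else 0.

Fixpoint subdepths (b : btree) : seq nat :=
  if b is Wedge s t then subdepths s ++ left_depth t :: subdepths t else [::].

(** [Phi] contracts each maximal left spine to a node, whose children come from the right subtrees
    hanging off that spine. *)
Lemma multidegree_Phi b : multidegree (Phi b) = left_depth b :: subdepths b.
Proof.
elim: b => [|s IHs t IHt] //=; case: (Phi s) IHs => ps /= [<- <-].
by rewrite size_rcons map_rcons flatten_rcons IHt.
Qed.

Lemma subdegrees_Phi b : subdegrees (Phi b) = subdepths b.
Proof. by rewrite /subdegrees multidegree_Phi. Qed.

Lemma left_depth_foldl b bs :
  left_depth (foldl Wedge b bs) = left_depth b + size bs.
Proof. by elim: bs b => [|c bs IH] b /=; rewrite ?addn0 // IH addSnnS. Qed.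

Lemma subdepths_foldl b bs : subdepths (foldl Wedge b bs) =
  subdepths b ++ flatten [seq left_depth c :: subdepths c | c <- bs].
Proof.
by elim: bs b => [|c bs IH] b /=; rewrite ?cats0 // IH /= -catA.
Qed.

(** * Rotations: invariant residues and reduced trees *)

Lemma right_rotation_mod k s t : right_rotation k s t ->
  left_depth s = left_depth t %[mod k] /\
  map (modn^~ k) (subdepths s) = map (modn^~ k) (subdepths t).
Proof.
elim=> {s t} [t|s s' u _ [dE sE]|s u u' _ [dE sE]] /=; last first.
- by rewrite !map_cat /= sE dE.
- by rewrite !map_cat /= sE -addn1 -(addn1 (left_depth s')) -modnDml dE modnDml.
(* At the root, the left depth drops by [k] and the letter of [t 1] grows by [k]; all other letters
   keep their values and places. *)
rewrite /wedges left_depth_foldl subdepths_foldl left_depth_foldl subdepths_foldl.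
rewrite !size_map !size_iota -addn1 -(addn1 (left_depth _)) addnAC modnDr.
split=> //; rewrite -catA map_cat [in RHS]map_cat; congr (_ ++ _).
(* For [k = 0] the rotation changes nothing. *)
case: k => [|k]; first by rewrite /= !cats0 addn0.
rewrite -[in RHS]addn1 iotaD /= !map_cat flatten_cat /= cats0 !map_cat /=.
by rewrite modnDr add2n -!catA addn1.
Qed.

Lemma bequiv_mod k s t : bequiv k s t ->
  left_depth s = left_depth t %[mod k] /\
  map (modn^~ k) (subdepths s) = map (modn^~ k) (subdepths t).
Proof.
elim=> {s t} [s t /right_rotation_mod|s|s t _ [-> ->]|s t u _ [-> ->] _ [-> ->]] //.
Qed.

Definition reduced k b := all (fun x => x < k) (subdepths b).

(** The rotation creates a right subtree [wedges t 1 k], whose left depth is at least [k]. Hence no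
    left rotation starts from a reduced tree. *)
Lemma right_rotation_unreduced k s t : right_rotation k s t -> ~~ reduced k t.
Proof.
rewrite /reduced; elim=> {s t} [t|s s' u _ nr|s u u' _ nr] /=.
- rewrite all_cat /= /wedges left_depth_foldl size_map size_iota.
  by rewrite ltnNge leq_addl /= andbF.
- by rewrite all_cat negb_and nr.
- by rewrite all_cat /= !negb_and nr !orbT.
Qed.

Lemma ble_reduced k s t : ble k s t -> reduced k t -> s = t.
Proof.
elim=> {s t} [s t /right_rotation_unreduced/negbTE-> //|//|x y z _ IH1 _ IH2 rx].
by have Ey := IH1 rx; rewrite IH2 Ey.
Qed.

Lemma left_depth_split k b : k <= left_depth b ->
  exists2 c, left_depth c + k = left_depth b &
  exists2 bs, size bs = k & b = foldl Wedge c bs.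
Proof.
elim: k b => [|k IH] b; first by exists b; rewrite ?addn0 //; exists [::].
case: b => [|s t] //= /IH[c Ec [bs sz Es]].
exists c; first by rewrite addnS Ec.
by exists (rcons bs t); rewrite ?size_rcons ?sz // foldl_rcons -Es.
Qed.

Lemma ble_foldl k s t bs : ble k s t ->
  ble k (foldl Wedge s bs) (foldl Wedge t bs).
Proof.
elim: bs s t => [|c bs IH] s t st //=; apply: IH.
elim: st => {s t} [s t st|s|x y z _ IH1 _ IH2].
- exact/rt_step/right_rotation_l.
- exact: rt_refl.
- exact: rt_trans IH1 IH2.
Qed.

Lemma ble_Wedge k s s' t t' : ble k s s' -> ble k t t' ->
  ble k (Wedge s t) (Wedge s' t').
Proof.
move=> ss tt; apply: rt_trans (ble_foldl _ _ _ [:: t] ss) => /=.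
elim: tt => {t t'} [t t' st|t|x y z _ IH1 _ IH2].
- exact/rt_step/right_rotation_r.
- exact: rt_refl.
- exact: rt_trans IH1 IH2.
Qed.

Lemma left_rotation_foldl s c bs :
  left_rotation (size bs) (Wedge s (foldl Wedge c bs))
                (foldl Wedge (Wedge s c) bs).
Proof.
(* The default [Leaf] is never read: only indices up to [(size bs).+1] occur. *)
pose t := nth Leaf [:: s, c & bs].
have := right_rotation_root (size bs) t; rewrite /left_rotation /wedges.
have E2 : [seq t j | j <- iota 2 (size bs)] = bs.
  by rewrite (map_nth_iota Leaf) /= ?drop0 ?take_size; last lia.
rewrite E2 -foldl_rcons.
have -> : rcons [seq t j | j <- iota 1 (size bs)] (t (size bs).+1) = c :: bs.
  rewrite -map_rcons -cats1 -[[:: _]]/(iota (1 + size bs) 1) -iotaD addn1.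
  by rewrite (map_nth_iota Leaf) /= ?drop0 ?take_size; last lia.
by [].
Qed.

Lemma reduced_foldl k b bs : reduced k (foldl Wedge b bs) =
  reduced k b && all (fun c => (left_depth c < k) && reduced k c) bs.
Proof.
elim: bs b => [|c bs IH] b /=; first by rewrite andbT.
by rewrite IH /reduced /= all_cat /= !andbA.
Qed.

(** Left rotations lift the last [k] subtrees on the spine of [t] to the main spine, whose length
    [reduced] does not bound; the left depth of [t] decreases until it is below [k]. *)
Lemma reduce_Wedge k s t : 0 < k -> reduced k s -> reduced k t ->
  exists2 c, reduced k c & ble k c (Wedge s t).
Proof.
move=> k0; have [d] := ubnP (left_depth t).
elim: d t => // d IH t lt_d rs rt.
have [lt_k|] := ltnP (left_depth t) k.
  exists (Wedge s t); last exact: rt_refl.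
  by rewrite /reduced /= all_cat /= lt_k; apply/andP.
move=> /left_depth_split[c Ec [bs szbs Et]].
move: rt; rewrite Et reduced_foldl => /andP[rc rbs].
have lt_c : left_depth c < d by lia.
have [u ru le_u] := IH c lt_c rs rc.
exists (foldl Wedge u bs); first by rewrite reduced_foldl ru.
apply: rt_trans (ble_foldl _ _ _ bs le_u); apply: rt_step.
by rewrite -szbs; exact: left_rotation_foldl.
Qed.

Lemma reduce k b : 0 < k -> exists2 c, reduced k c & ble k c b.
Proof.
move=> k0; elim: b => [|s [s' rs les] t [t' rt let_]].
  by exists Leaf; last exact: rt_refl.
have [c rc le_c] := reduce_Wedge _ _ _ k0 rs rt.
by exists c => //; apply: rt_trans le_c; exact: ble_Wedge.
Qed.

Lemma ble_bequiv k s t : ble k s t -> bequiv k s t.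
Proof.
elim=> {s t} [s t st|s|x y z _ IH1 _ IH2].
- exact: rst_step.
- exact: rst_refl.
- exact: rst_trans IH2 IH1.
Qed.

(** * Classes of plane trees as fibres of the residue word *)

Lemma pequiv_mod k p q : pequiv k p q ->
  map (modn^~ k) (subdegrees p) = map (modn^~ k) (subdegrees q).
Proof. by case=> s [t [<- <- /bequiv_mod[_]]]; rewrite !subdegrees_Phi. Qed.

Lemma mod_reduced k t : all (fun x => x < k) t -> map (modn^~ k) t = t.
Proof. by elim: t => //= x t IH /andP[xk /IH->]; rewrite modn_small. Qed.

(** In a reduced tree the letters are their own residues, so both sides reduce to the same tree. *)
Lemma mod_pequiv k p q : 0 < k ->
  map (modn^~ k) (subdegrees p) = map (modn^~ k) (subdegrees q) -> pequiv k p q.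
Proof.
move=> k0; rewrite -(PsiK p) -(PsiK q) !subdegrees_Phi => Epq.
have [c rc /ble_bequiv cp] := reduce _ (Psi p) k0.
have [d rd /ble_bequiv dq] := reduce _ (Psi q) k0.
have Ecd : subdepths c = subdepths d.
  rewrite -(mod_reduced _ _ rc) -(mod_reduced _ _ rd).
  by rewrite (bequiv_mod _ _ _ cp).2 (bequiv_mod _ _ _ dq).2.
have cd : c = d.
  apply: (can_inj PhiK); apply: subdegrees_inj; rewrite ?subdegrees_Phi //.
  by rewrite -!size_multidegree !multidegree_Phi Ecd.
exists (Psi p), (Psi q); split=> //.
by apply: rst_trans dq; rewrite -cd; exact: rst_sym.
Qed.

Lemma pequivP k p q : 0 < k -> pequiv k p q <->
  map (modn^~ k) (subdegrees p) = map (modn^~ k) (subdegrees q).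
Proof. by move=> k0; split=> [/pequiv_mod|/(mod_pequiv _ _ _ k0)]. Qed.

Lemma pequiv_nodes k p q : pequiv k p q -> nodes p = nodes q.
Proof.
case=> s [t [<- <- /bequiv_mod[_ /(congr1 size)]]].
by rewrite -!size_multidegree !multidegree_Phi /= !size_map => ->.
Qed.

Lemma pequiv_reduced k p : 0 < k ->
  exists2 u, pequiv k p u & all (fun x => x < k) (subdegrees u).
Proof.
move=> k0; have [c rc /ble_bequiv cp] := reduce _ (Psi p) k0.
exists (Phi c); last by rewrite subdegrees_Phi.
by exists (Psi p), c; rewrite PsiK; split=> //; exact: rst_sym.
Qed.

Lemma ple_reduced k p u : all (fun x => x < k) (subdegrees u) ->
  ple k p u -> p = u.
Proof.
move=> ru [s [t [<- Eu le_st]]]; rewrite -Eu; congr Phi.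
by apply: ble_reduced le_st _; rewrite /reduced -subdegrees_Phi Eu.
Qed.

(** * Quotient words and tight residue words *)

Definition comb k (a r : seq nat) : seq nat :=
  [seq x.1 * k + x.2 | x <- zip a r].

(* The condition under which adding r to the multiples a k destroys no
   Lukasiewicz word: every suffix sum of r fits into the slack |w| mod k. *)
Fixpoint residue_tight k (r : seq nat) : bool :=
  if r is x :: r' then (x + sumn r' <= size r' %% k) && residue_tight k r'
  else true.

Lemma size_comb k a r : size a = size r -> size (comb k a r) = size r.
Proof. by move=> sz; rewrite size_map size_zip sz minnn. Qed.

Lemma sumn_comb k a r : size a = size r ->
  sumn (comb k a r) = sumn a * k + sumn r.
Proof.
elim: a r => [|x a IH] [|y r] //= [/IH E].
by move: E; rewrite /comb => ->; lia.
Qed.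

Lemma comb_divK k t r : map (modn^~ k) t = r ->
  comb k (map (divn^~ k) t) r = t.
Proof.
move=> <-; elim: t => //= x t IH; rewrite /comb /= -divn_eq.
by move: IH; rewrite /comb => ->.
Qed.

Lemma comb_mod k a r : size a = size r -> all (fun x => x < k) r ->
  map (modn^~ k) (comb k a r) = r.
Proof.
elim: a r => [|x a IH] [|y r] //= [sz] /andP[yk rk].
by rewrite modnMDl modn_small // [map _ _]IH.
Qed.

Lemma comb_div k a r : size a = size r -> all (fun x => x < k) r ->
  map (divn^~ k) (comb k a r) = a.
Proof.
elim: a r => [|x a IH] [|y r] //= [sz] /andP[yk rk].
by rewrite divnMDl ?divn_small ?addn0 ?[map _ _]IH //; case: k yk {IH rk}.
Qed.

Lemma sumn_zeros n : sumn (nseq n 0) = 0.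
Proof. by rewrite sumn_nseq. Qed.

Lemma luka_comb_zeros k a r : size a = size r ->
  lukasiewicz (comb k a r) -> lukasiewicz (comb k a (nseq (size r) 0)).
Proof.
elim: a r => [|x a IH] [|y r] //= [sz] /andP[le_s /IH->//]; rewrite andbT.
have sz0 : size a = size (nseq (size r) 0) by rewrite size_nseq.
move: le_s; rewrite -!/(comb _ _ _) !sumn_comb // !size_comb // size_nseq sumn_zeros.
lia.
Qed.

(** A multiple of [k] that is at most a length [l] is at most [l %/ k * k], which leaves room
    [l %% k] for the residues. *)
Lemma residue_tight_luka k a r : 0 < k -> size a = size r -> residue_tight k r ->
  lukasiewicz (comb k a (nseq (size r) 0)) -> lukasiewicz (comb k a r).
Proof.
move=> k0; elim: a r => [|x a IH] [|y r] //= [sz] /andP[le_r ar] /andP[le_s g].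
rewrite [lukasiewicz _]IH // andbT.
have sz0 : size a = size (nseq (size r) 0) by rewrite size_nseq.
move: le_s; rewrite -!/(comb _ _ _) !sumn_comb // !size_comb // size_nseq sumn_zeros.
rewrite !addn0 -mulnDl -leq_divRL // => le_s.
rewrite [leqRHS](divn_eq (size r) k) addnACA -mulnDl leq_add // leq_mul2r.
by rewrite le_s orbT.
Qed.

Lemma luka_zeros n : lukasiewicz (nseq n 0).
Proof. by elim: n => //= n ->; rewrite sumn_zeros. Qed.

Lemma comb_zeros k n : comb k (nseq n 0) (nseq n 0) = nseq n 0.
Proof. by elim: n => //= n IH; rewrite /comb /= [map _ _]IH. Qed.

Lemma luka_residue_tight k r : 0 < k ->
  (forall a, size a = size r ->
     lukasiewicz (comb k a (nseq (size r) 0)) -> lukasiewicz (comb k a r)) ->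
  residue_tight k r.
Proof.
move=> k0; elim: r => //= y r IH H; apply/andP; split.
  (* This test word uses up the largest multiple of [k] that fits, so the remaining slack is exactly
     [size r %% k]. *)
  pose a := size r %/ k :: nseq (size r) 0.
  have sza : size a = (size r).+1 by rewrite /= size_nseq.
  have ga : lukasiewicz (comb k a (0 :: nseq (size r) 0)).
    rewrite /= -!/(comb _ _ _) comb_zeros luka_zeros sumn_zeros size_nseq !addn0.
    by rewrite leq_trunc_div.
  have /= /andP[+ _] := H a sza ga.
  rewrite -!/(comb _ _ _) sumn_comb ?size_comb ?size_nseq // sumn_zeros.
  by rewrite [leqRHS](divn_eq (size r) k) -addnA leq_add2l.
apply: IH => a sz g.
(* A leading quotient [0] turns a test word for [r] into one for [y :: r]. *)
have ga : lukasiewicz (comb k (0 :: a) (0 :: nseq (size r) 0)).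
  by rewrite /= -!/(comb _ _ _) g andbT; exact: luka_sumn.
by have /= /andP[_] := H (0 :: a) (congr1 S sz) ga.
Qed.

Lemma residue_tight_lt k r : 0 < k -> residue_tight k r -> all (fun x => x < k) r.
Proof.
move=> k0; elim: r => //= y r IH /andP[le_y /IH->]; rewrite andbT.
by apply: leq_ltn_trans (ltn_pmod (size r) k0); lia.
Qed.

(** * Admissibility as tightness of the residue word *)

Lemma residue_tight_zeros k n : residue_tight k (nseq n 0).
Proof. by elim: n => //= n ->; rewrite sumn_zeros. Qed.

(** The last letter of [x] has slack [size y %% k = 0], which forces [y] to vanish. Every letter of
    [x] is followed by fewer than [k] letters of [x], so its slack is that number, as in a
    Lukasiewicz word. *)
Lemma residue_tight_cat k x y : 0 < size x <= k -> k %| size y ->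
  residue_tight k (x ++ y) = lukasiewicz x && (sumn y == 0).
Proof.
move=> + dky; elim: x => // x0 [|x1 x] IH /=.
  move=> _; rewrite (eqP dky) addn0 leqn0 addn_eq0 leqn0.
  have [/natnseq0P->|] := boolP (sumn y == 0); last by rewrite !andbF.
  by rewrite residue_tight_zeros !andbT.
move=> lt_k; rewrite [_ && residue_tight _ _]IH; last by apply: ltnW.
rewrite /= !sumn_cat size_cat -addSn -modnDmr (eqP dky) addn0 modn_small //.
have [s0|] := boolP (sumn y == 0); last by rewrite !andbF.
by rewrite (eqP s0) !addn0 !andbT.
Qed.

(** A value above [k] could be lowered by [k]. A positive [n] is itself a candidate, whereas [n = 0]
    gives [m = k]. *)
Lemma smallest_pos_residue_bounds n k m : 0 < k -> smallest_pos_residue n k m ->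
  0 < m <= k /\ (0 < n -> m <= n /\ k %| n - m).
Proof.
move=> k0 [m0 Em min_m]; split=> [|n0].
  rewrite m0 leqNgt; apply/negP => lt_km.
  have Emk : m - k = n %[mod k] by rewrite -modnDr subnK ?(ltnW lt_km).
  by have := min_m _ _ Emk; lia.
have le_mn := min_m n n0 erefl; split=> //.
by rewrite -eqn_mod_dvd // Em.
Qed.

Lemma admissibleP n k m u : 0 < k -> smallest_pos_residue n k m ->
  nodes u = n.+1 -> admissible n m u <-> residue_tight k (subdegrees u).
Proof.
move=> k0 hm Nu; have [mk le_mn] := smallest_pos_residue_bounds _ _ _ k0 hm.
have sz := size_subdegrees u; rewrite Nu /= in sz.
rewrite /admissible Nu multidegreeE Nu /=; set t := subdegrees u in sz *.
have gt : lukasiewicz t by exact: luka_subdegrees.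
have Eiota : m <= n ->
    [seq Posz (nth 0 (n - sumn t :: t) i) | i <- iota 1 m] = map Posz (take m t).
  move=> le_mn'; rewrite (map_comp Posz (nth 0 _)) (map_nth_iota 0) /= ?drop0 //.
  by rewrite sz; lia.
case: n => [|n] in Nu sz hm le_mn Eiota *.
  (* For [n = 0] tightness is vacuous; the star with [m] leaves is the required tree, its zero
     degrees matching the defaults of [nth]. *)
  rewrite (size0nil sz) /=; split=> // _; split=> //.
    by move=> i /andP[+ +]; rewrite leqn0 => /[swap] /eqP->.
  have [q] := subdegrees_surj _ (luka_zeros m); rewrite size_nseq => Nq Eq.
  exists q => //; rewrite multidegreeE Nq Eq sumn_zeros subn0 /=.
  congr (_ :: _).
  rewrite map_nseq; apply: (@eq_from_nth _ (Posz 0)).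
    by rewrite !size_map size_iota size_nseq.
  move=> i; rewrite size_nseq => lt_i.
  by rewrite nth_nseq lt_i (nth_map 0) ?size_iota // nth_iota //= nth_nil.
have {le_mn} [le_mn dk] := le_mn isT.
have szx : size (take m t) = m by rewrite size_takel ?sz.
have szy : size (drop m t) = n.+1 - m by rewrite size_drop sz.
rewrite (Eiota le_mn) -[X in residue_tight k X](cat_take_drop m t).
rewrite residue_tight_cat ?szx ?szy //.
split=> [[_ dr0 [q Nq Eq]]|/andP[gx s0]].
  apply/andP; split.
    rewrite -(_ : subdegrees q = take m t); first exact: luka_subdegrees.
    move: Eq; rewrite multidegreeE /= => -[_]; apply: inj_map.
    by move=> ? ? [].
  apply/natnseq0P; apply: (@eq_from_nth _ 0); first by rewrite size_nseq.
  move=> i; rewrite szy => lt_i; rewrite nth_drop nth_nseq if_same.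
  (* Index [0] of the multi-degree is the root, so letter [m + i] of [t] is the degree of index
     [(m + i).+1]. *)
  have := dr0 (m + i).+1 => /=; apply; lia.
have E : sumn t = sumn (take m t).
  by rewrite -{1}(cat_take_drop m t) sumn_cat (eqP s0) addn0.
split=> //.
  move=> [|i] // /andP[lt_m le_i] /=.
  move/natnseq0P: s0 => s0; rewrite -(cat_take_drop m t) nth_cat szx.
  rewrite ltnNge -ltnS lt_m /=.
  by rewrite s0 nth_nseq if_same.
have [q] := subdegrees_surj _ gx; rewrite szx => Nq Eq.
(* Both root degrees equal [m - sumn (take m t)]; the bounds on sums make the natural subtractions
   exact. *)
exists q => //; rewrite multidegreeE Nq Eq /= E; congr (_ :: _).
have := luka_sumn _ gx; rewrite szx; lia.
Qed.

(** * Sizes of classes *)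

Local Open Scope classical_set_scope.
Local Open Scope card_scope.

Definition quotients n k (r : seq nat) : set (seq nat) :=
  [set a | size a = n /\ lukasiewicz (comb k a r)].

(** The residue word is constant on a class, so a member is determined by its letterwise quotients
    by [k]. *)
Lemma class_card_quotients n k p : 0 < k -> nodes p = n.+1 ->
  [set q | pequiv k p q] #= quotients n k (map (modn^~ k) (subdegrees p)).
Proof.
move=> k0 Np; set r := map _ _.
have rk : all (fun x => x < k) r.
  by rewrite all_map; apply/allP => x _ /=; rewrite ltn_pmod.
have szr : size r = n by rewrite size_map size_subdegrees Np.
pose f q := map (divn^~ k) (subdegrees q).
have -> : quotients n k r = f @` [set q | pequiv k p q].
  apply/seteqP; split=> [a [sza ga]|_ [q pq <-]] /=.
    have szar : size a = size r by rewrite sza szr.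
    have [q Nq Eq] := subdegrees_surj _ ga; exists q; last first.
      by rewrite /f Eq comb_div.
    by apply: mod_pequiv => //; rewrite Eq comb_mod.
  split; first by rewrite size_map size_subdegrees -(pequiv_nodes _ _ _ pq) Np.
  by rewrite comb_divK ?luka_subdegrees // -(pequiv_mod _ _ _ pq).
rewrite card_eq_sym; apply: inj_card_eq => q q' /set_mem /= pq /set_mem /= pq' ff.
apply: subdegrees_inj.
  by rewrite -(pequiv_nodes _ _ _ pq) (pequiv_nodes _ _ _ pq').
rewrite -(comb_divK k (subdegrees q) r) -1?(pequiv_mod _ _ _ pq) //.
rewrite -(comb_divK k (subdegrees q') r) -1?(pequiv_mod _ _ _ pq') //.
by rewrite -!/(f _) ff.
Qed.

Lemma quotients_sub_zeros n k r : size r = n ->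
  quotients n k r `<=` quotients n k (nseq n 0).
Proof.
by move=> <- a [sza ga]; split=> //; exact: luka_comb_zeros.
Qed.

Lemma finite_quotients_zeros n k : 0 < k -> finite_set (quotients n k (nseq n 0)).
Proof.
(* Each quotient is at most the total sum, hence at most [n], so finitely many tuples cover all
   words. *)
move=> k0; pose f (t : n.-tuple 'I_n.+1) := map val t.
apply: (@sub_finite_set _ _ (f @` setT)); last exact/finite_image/finite_finset.
move=> a [sza /luka_sumn]; rewrite sumn_comb ?size_comb ?size_nseq //.
rewrite sumn_zeros addn0 => le_a.
have le_an : {in a, forall x, x <= n}.
  move=> x xa; rewrite (leq_trans _ le_a) // (leq_trans _ (leq_pmulr _ k0)) //.
  by rewrite sumnE (big_rem x) //= leq_addr.
have szi : size (map (@inord n) a) == n by rewrite size_map sza.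
exists (Tuple szi) => //; rewrite /f /= -map_comp map_id_in // => x /le_an le_x /=.
by rewrite inordK.
Qed.

(** This turns maximal size into equality of quotient sets. *)
Lemma finite_card_le_eq (T : choiceType) (A B : set T) : finite_set B ->
  A `<=` B -> B #<= A -> A = B.
Proof.
move=> fB AB BA; have fA := sub_finite_set AB fB.
have /(fcard_eq fA fB) E : A #= B.
  by rewrite card_eq_le BA subset_card_le.
rewrite -(fset_setK fA) -(fset_setK fB).
suff -> : fset_set A = fset_set B by [].
by apply/eqP; rewrite eqEfcard E leqnn andbT -fset_set_sub.
Qed.

Lemma star_subdegrees n :
  exists2 p, nodes p = n.+1 & subdegrees p = nseq n 0.
Proof. by have := subdegrees_surj _ (luka_zeros n); rewrite size_nseq. Qed.

Lemma quotients_residue_tight n k r : 0 < k -> size r = n ->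
  quotients n k r = quotients n k (nseq n 0) <-> residue_tight k r.
Proof.
move=> k0 szr; split=> [E|ar].
  apply: luka_residue_tight => // a sza ga.
  suff [] : quotients n k r a by [].
  by rewrite E; split; rewrite -?szr.
apply/seteqP; split; first exact: quotients_sub_zeros.
by rewrite -szr => a [sza ga]; split=> //; exact: residue_tight_luka.
Qed.

Lemma pequiv_class k p q : 0 < k -> pequiv k p q ->
  [set q' | pequiv k p q'] = [set q' | pequiv k q q'].
Proof.
by move=> k0 /pequiv_mod E; apply/seteqP; split=> q' /=; rewrite !pequivP // E.
Qed.

Lemma largest_classP n k u : 0 < k -> nodes u = n.+1 ->
  all (fun x => x < k) (subdegrees u) ->
  largest_kclass n k [set q | pequiv k u q] <-> residue_tight k (subdegrees u).
Proof.
move=> k0 Nu ru; set r := subdegrees u.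
have szr : size r = n by rewrite size_subdegrees Nu.
have Cu := class_card_quotients _ _ _ k0 Nu; rewrite mod_reduced // -/r in Cu.
rewrite -(quotients_residue_tight _ _ _ k0 szr); split=> [[_ maxC]|E].
  (* The star has zero residue word, so its class realises the quotient set that contains all
     others. *)
  have [p Np Ep] := star_subdegrees n.
  have Cp := class_card_quotients _ _ _ k0 Np.
  rewrite Ep map_nseq mod0n in Cp.
  apply: finite_card_le_eq; first exact: finite_quotients_zeros.
    exact: quotients_sub_zeros.
  rewrite -(card_le_eql Cp) -(card_le_eqr Cu); apply: maxC.
  by exists p.
split; first by exists u.
move=> _ [p Np ->]; have Cp := class_card_quotients _ _ _ k0 Np.
rewrite (card_le_eql Cp) (card_le_eqr Cu) E; apply: subset_card_le.
by apply: quotients_sub_zeros; rewrite size_map size_subdegrees Np.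
Qed.

Theorem theorem2p16 (n k : nat) (hk : 1 <= k) (m : nat)
    (hm : smallest_pos_residue n k m) (C : set ptree) :
  kclass n k C ->
  (largest_kclass n k C <->
   exists2 u : ptree, minimal_in k C u & admissible n m u).
Proof.
case=> p Np ->; split=> [maxC|[u [pu _] au]].
  have [u pu ru] := pequiv_reduced _ p hk.
  have Nu : nodes u = n.+1 by rewrite -(pequiv_nodes _ _ _ pu).
  exists u; first by split=> // q _; exact: ple_reduced.
  apply/(admissibleP _ _ _ _ hk hm Nu)/(largest_classP _ _ _ hk Nu ru).
  by rewrite -(pequiv_class _ _ _ hk pu).
have Nu : nodes u = n.+1 by rewrite -(pequiv_nodes _ _ _ pu).
move/(admissibleP _ _ _ _ hk hm Nu): au => au.
rewrite (pequiv_class _ _ _ hk pu); apply/largest_classP => //.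
(* Tightness bounds each letter by a remainder modulo [k], so [u] is reduced. *)
exact: residue_tight_lt.
Qed.
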